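(* Let $A\in\mathbb{R}^{n\times n}$, $B\in\mathbb{R}^{n\times m}$, and let $F\in\mathbb{R}^{r\times n}$ have full row rank $r$. Consider the system $\dot{x}(t)=Ax(t)+Bu(t)$. A control law of the form $u(t)=-ZFx(t)$, $Z\in\mathbb{R}^{m\times r}$, can drive $Fx(t)\to\mathbf{0}$ as $t\to\infty$ at an arbitrary rate of convergence from any initial condition $Fx(t_0)$ by placing $r$ poles of a subsystem of order $r$ (in the sense made precise in the context) if and only if both of the following conditions hold: $$\operatorname{rank}\begin{pmatrix} FA \\ F \end{pmatrix}=\operatorname{rank}(F),$$ $$\operatorname{rank}\begin{pmatrix}sF-FA & FB\end{pmatrix}=\operatorname{rank}(F)\quad\text{for all } s\in\mathbb{C}.$$
   Context: ''The control law $u=-ZFx$ can drive $Fx(t)\to\mathbf 0$ at an arbitrary rate of convergence from any initial condition by placing $r$ poles of a subsystem of order $r$'' means: for every multiset $\Lambda=\{\lambda_1,\dots,\lambda_r\}$ of $r$ complex numbers with negative real parts that is closed under complex conjugation, there exist $Z\in\mathbb{R}^{m\times r}$ and $M\in\mathbb{R}^{r\times r}$ such that every solution of the closed-loop system $\dot{x}=(A-BZF)x$ satisfies the order-$r$ autonomous equation $\frac{d}{dt}(Fx(t))=M\,Fx(t)$ (equivalently $F(A-BZF)=MF$), and the eigenvalues of $M$, counted with algebraic multiplicity, are exactly $\Lambda$ (so $Fx(t)\to\mathbf 0$ for every initial condition, at a rate prescribed by $\Lambda$). *)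

(* Defs.v *)
From HB Require Import structures.
From mathcomp Require Import all_boot all_order all_algebra.
From mathcomp Require Import all_classical all_reals all_analysis.
From mathcomp Require Import complex.

Set Implicit Arguments.
Unset Strict Implicit.
Unset Printing Implicit Defensive.

Import Order.TTheory GRing.Theory Num.Theory.
Import numFieldNormedType.Exports.
Local Open Scope ring_scope.

Definition complexify (R : rcfType) (p q : nat) (M : 'M[R]_(p, q)) :
  'M[R[i]]_(p, q) := map_mx (real_complex R) M.

(* The eigenvalues of a real matrix are taken in R[i]; the algebraic
   multiplicity of z is its multiplicity as a root of the characteristic
   polynomial, 0 when z is not an eigenvalue. *)
Definition alg_mult (R : rcfType) (p : nat) (M : 'M[R]_p) (z : R[i]) : nat :=
  mup z (char_poly (complexify M)).

(* Multisets of complex numbers are represented by sequences, whose order is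
   irrelevant below. Closure under conjugation respects multiplicities. *)
Definition conj_closed (R : rcfType) (L : seq R[i]) : Prop :=
  perm_eq (map (@conjc R) L) L.

Definition trajectory (R : realType) (n m : nat)
    (A : 'M[R]_n) (B : 'M[R]_(n, m))
    (u : R -> 'cV[R]_m) (x : R -> 'cV[R]_n) : Prop :=
  forall t : R, is_derive t 1 x (A *m x t + B *m u t).

(* No initial condition is imposed: the trajectories range over the whole real
   line, hence over all values of x, and so of F x, at any initial time t0. *)
Definition arbitrary_rate_by_pole_placement (R : realType) (n m r : nat)
    (A : 'M[R]_n) (B : 'M[R]_(n, m)) (F : 'M[R]_(r, n)) : Prop :=
  forall L : seq R[i],
    size L = r -> (forall z, z \in L -> complex.Re z < 0) -> conj_closed L ->
    exists (Z : 'M[R]_(m, r)) (M : 'M[R]_r),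
      (forall x : R -> 'cV[R]_n,
         trajectory A B (fun t => - (Z *m F *m x t)) x ->
         forall t : R, is_derive t 1 (fun s => F *m x s) (M *m (F *m x t))) /\
      (forall z : R[i], alg_mult M z = count_mem z L).

(* Main.v *)
(* Linear ODEs have solutions through every point, so the quotient dynamics
   amount to F (A - B Z F) = M F. This forces F A = N F, the first rank condition;
   as F has full row rank, M = N - (F B) Z, and the second condition is the Hautus
   test for the pair (N, F B). If it fails at s, then s is an eigenvalue of
   N - (F B) Z for all Z, which is incompatible with both spectra {-1} and {-2}.
   If it holds, the pair is controllable, and poles are placed by Heymann's
   reduction to a single input followed by the control canonical form. *)

Require Import Defs.
From mathcomp Require Import all_boot all_order all_algebra.
From mathcomp Require Import all_classical all_reals all_analysis.
From mathcomp Require Import complex.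

Set Implicit Arguments.
Unset Strict Implicit.
Unset Printing Implicit Defensive.

Import Order.TTheory GRing.Theory Num.Theory.
Import numFieldNormedType.Exports.
Local Open Scope classical_set_scope.
Local Open Scope ring_scope.

(** * Krylov spaces and Heymann's reduction to a single input *)

(* The Krylov space of [c] under [a] is everything. Matrices act on row vectors,
   so controllability of (N, G) reads [generates G^T N^T]. *)
Definition generates (K : fieldType) (m r : nat)
    (c : 'M[K]_(m, r)) (a : 'M[K]_r) :=
  forall S : 'M[K]_r, (c <= S)%MS -> (S *m a <= S)%MS -> row_full S.

(* A chain that cannot be prolonged spans a stable subspace containing [c]:
   if all [v k *m a + u *m c] lie in the span, so do the rows of [c]. *)
Lemma generates_chain (K : fieldType) m r (c : 'M[K]_(m, r)) (a : 'M[K]_r) :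
  generates c a -> forall i, (i <= r)%N ->
  exists (v : nat -> 'rV[K]_r) (u : nat -> 'rV[K]_m),
    [/\ row_free (\matrix_(k < i) v k),
        (0 < i)%N -> (v 0%N <= c)%MS &
        forall k, (k.+1 < i)%N -> v k.+1 = v k *m a + u k *m c].
Proof.
move=> gen_ca; elim=> [_|i IHi lt_ir].
  exists (fun=> 0), (fun=> 0); split=> //.
  by rewrite /row_free flatmx0 mxrank0.
have [v [u [free_v v0c v_step]]] := IHi (ltnW lt_ir).
set V := \matrix_(k < i) v k in free_v.
have sub_v k : (k < i)%N -> (v k <= V)%MS.
  move=> lt_ki; rewrite -[v k](rowK (fun k : 'I_i => v k) (Ordinal lt_ki)).
  exact: row_sub.
(* The part of the next vector that the input does not affect; the default 0 makes the first vector
   a combination of the rows of [c]. *)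
pose l := if i is j.+1 then v j *m a else 0.
have l_step k : i = k.+1 -> l = v k *m a by rewrite /l => ->.
have [u0 new_u0] : exists u0 : 'rV[K]_m, ~~ ((l + u0 *m c)%R <= V)%MS.
  have [sub_lV|] := boolP (l <= V)%MS; last first.
    by exists 0; rewrite mul0mx addr0.
  have [sub_cV|/row_subPn[j sub_cjV]] := boolP (c <= V)%MS; last first.
    exists (delta_mx 0 j); rewrite -rowE; apply: contra sub_cjV => sub_jV.
    by rewrite -(addKr l (row j c)) addmx_sub // eqmx_opp.
  (* With [l] and the rows of [c] in the span, [v k *m a = v k.+1 - u k *m c] stays there, so the
     span is everything, although its rank is [i < r]. *)
  have /eqP: row_full <<V>>%MS.
    apply: gen_ca; first by rewrite genmxE.
    rewrite (eqmxMr a (genmxE V)) genmxE; apply/row_subP => k.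
    rewrite row_mul rowK.
    have [lt_ki|le_ik] := ltnP k.+1 i.
      rewrite -[_ *m a](addrK (u k *m c)) -v_step // addmx_sub ?sub_v //.
      by rewrite eqmx_opp (submx_trans (submxMl _ _)).
    by rewrite -l_step //; apply/eqP; rewrite eqn_leq le_ik ltn_ord.
  by rewrite genmxE (eqP free_v) => eq_ir; rewrite eq_ir ltnn in lt_ir.
pose w := l + u0 *m c; pose v' k := if k == i then w else v k.
pose u' k := if k.+1 == i then u0 else u k.
exists v', u'; split=> [|_|k].
- rewrite /row_free eqn_leq rank_leq_row -{1}(eqP free_v) /=.
  have lt_V : (V < V + w)%MS.
    rewrite ltmxE addsmxSl /=; apply: contra new_u0.
    by apply: submx_trans; exact: addsmxSr.
  apply: (leq_trans (rank_ltmx lt_V)); apply: mxrankS.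
  rewrite addsmx_sub; apply/andP; split; last first.
    by have := row_sub ord_max (\matrix_(k < i.+1) v' k); rewrite rowK /v' eqxx.
  apply/row_subP => k; rewrite rowK.
  have := row_sub (widen_ord (leqnSn i) k) (\matrix_(k < i.+1) v' k).
  by rewrite rowK /v' /= ltn_eqF.
- rewrite /v'; case: eqP => [/esym i0|/eqP]; last by rewrite eq_sym -lt0n.
  by rewrite /w /l i0 add0r submxMl.
- rewrite ltnS /v' /u' => le_ki; rewrite (ltn_eqF le_ki).
  case: eqP => [def_i|/eqP ne_ki]; first by rewrite /w (l_step k).
  by rewrite v_step // ltn_neqAle ne_ki.
Qed.

(* Heymann's lemma: feedback reduces to a single input. *)
Lemma generates_feedback (K : fieldType) m r (c : 'M[K]_(m, r)) (a : 'M[K]_r) :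
  generates c a ->
  exists (w : 'rV[K]_m) (Z : 'M[K]_(r, m)), generates (w *m c) (a + Z *m c).
Proof.
move=> gen_ca.
have [v [u [free_v v0c v_step]]] := generates_chain gen_ca (leqnn r).
case: r => [|r] in c a gen_ca v u free_v v0c v_step *.
  by exists 0, 0 => S _ _; rewrite /row_full -leqn0 rank_leq_row.
have [w def_v0] := submxP (v0c isT).
set V := \matrix_(k < r.+1) v k in free_v.
have uV : V \in unitmx by rewrite -row_free_unit.
(* Solves [v k *m Z = u k] for all [k], which turns the chain into the orbit of [v 0] under
   [a + Z *m c]. *)
pose Z := invmx V *m \matrix_(k < r.+1) u k.
exists w, Z => S; rewrite -def_v0 => sub_v0 sub_Sb.
rewrite -sub1mx -(mulVmx uV) (submx_trans (submxMl _ _)) //.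
apply/row_subP => -[k lt_kr]; rewrite rowK /=.
elim: k lt_kr => // k IHk lt_kr; rewrite v_step //.
suff -> : v k *m a + u k *m c = v k *m (a + Z *m c).
  by rewrite (submx_trans _ sub_Sb) // submxMr // IHk // ltnW.
rewrite mulmxDr mulmxA; congr (_ + _ *m c).
rewrite -[v k](rowK (fun k : 'I_r.+1 => v k) (Ordinal (ltnW lt_kr))).
by rewrite -row_mul /Z mulmxA mulmxV // mul1mx rowK.
Qed.

(** * Control canonical form, pole placement and the Hautus test *)

Lemma char_poly_tr (K : comNzRingType) n (A : 'M[K]_n) :
  char_poly A^T = char_poly A.
Proof.
rewrite /char_poly -[RHS]det_tr; congr (\det _).
by apply/matrixP => i j; rewrite !mxE eq_sym.
Qed.

Lemma char_poly_sim (K : fieldType) n (P A B : 'M[K]_n) :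
  P \in unitmx -> P *m A = B *m P -> char_poly A = char_poly B.
Proof.
move=> uP eqPA; have eqP_char :
    map_mx polyC P *m char_poly_mx A = char_poly_mx B *m map_mx polyC P.
  by rewrite mulmxBr mulmxBl scalar_mxC -!map_mxM eqPA.
have nzPX : \det (map_mx polyC P) != 0.
  by rewrite det_map_mx polyC_eq0 -unitfE -unitmxE.
have := congr1 determinant eqP_char; rewrite !det_mulmx mulrC.
exact: mulIf.
Qed.

(* Transpose of [companionmx p], with a size that does not depend on p. *)
Definition cocompanion (K : nzRingType) (r : nat) (p : {poly K}) : 'M[K]_r.+1 :=
  (\matrix_(i, j) (j.+1 == i :> nat)%:R)
    - (\col_i p`_i) *m delta_mx (0 : 'I_1) ord_max.

Lemma char_poly_cocompanion (K : comNzRingType) r (p : {poly K}) :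
  p \is monic -> size p = r.+2 -> char_poly (cocompanion r p) = p.
Proof.
move=> p_monic size_p; rewrite -[RHS]companionmxK // -char_poly_tr.
have -> : (cocompanion r p)^T
    = castmx (congr1 predn size_p, congr1 predn size_p) (companionmx p).
  apply/matrixP => i j; rewrite castmxE !mxE /= size_p big_ord1 !mxE /= -val_eqE /=.
  case: (i =P r :> nat) => [->|_]; first by rewrite gtn_eqF // mulr1 add0r.
  by rewrite mulr0 subr0.
have char_cast n n' (e : n = n') (M : 'M[K]_n) :
    char_poly (castmx (e, e) M) = char_poly M by case: n' / e; rewrite castmx_id.
exact: char_cast.
Qed.

(** One step of Horner's scheme. *)
Lemma drop_polyS (K : nzRingType) (p : {poly K}) i :
  drop_poly i p = drop_poly i.+1 p * 'X + (p`_i)%:P.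
Proof.
apply/polyP => k; rewrite coefD coefMX coefC !coef_drop_poly.
by case: k => [|k] /=; rewrite ?add0r // addr0 addnS.
Qed.

Lemma pole_placement_cyclic (K : fieldType) r (v : 'rV[K]_r) (a : 'M[K]_r)
    (p : {poly K}) :
  generates v a -> p \is monic -> size p = r.+1 ->
  exists g : 'cV[K]_r, char_poly (a + g *m v) = p.
Proof.
case: r => [|r] in v a *.
  move=> _ p_monic size_p; exists 0; rewrite /char_poly det_mx00.
  have /size_poly1P[k _ def_p] : size p == 1 by rewrite size_p.
  by move: p_monic; rewrite def_p monicE lead_coefC => /eqP->.
move=> gen_va p_monic size_p; pose q := char_poly a.
have size_q : size q = r.+2 by rewrite size_char_poly.
(* The Horner polynomials of q give the basis of the control canonical form:
   there, feedback along [v] changes all coefficients of q freely. *)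
pose E := \matrix_(j < r.+1) (v *m horner_mx a (drop_poly j.+1 q)).
have lastE : delta_mx (0 : 'I_1) ord_max *m E = v.
  rewrite -rowE rowK /=; have -> : drop_poly r.+1 q = 1.
    apply/polyP => k; rewrite coef_drop_poly coef1.
    case: k => [|k]; last by rewrite nth_default // size_q addSn ltnS leq_addl.
    have /monicP := char_poly_monic a.
    by rewrite lead_coefE size_char_poly.
  by rewrite rmorph1 mulmx1.
have E_a : E *m a = cocompanion r q *m E.
  apply/row_matrixP => i; rewrite mulmxBl -mulmxA lastE linearB /= !row_mul !rowK.
  have -> : row i (\col_i0 q`_i0) *m v = q`_i *: v.
    rewrite -mul_scalar_mx; congr (_ *m v).
    by apply/matrixP => x y; rewrite !ord1 !mxE mulr1n.
  apply: (canRL (addrK _)).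
  have -> : v *m horner_mx a (drop_poly i.+1 q) *m a + q`_i *: v
             = v *m horner_mx a (drop_poly i q).
    rewrite [in RHS]drop_polyS rmorphD rmorphM /= horner_mx_X horner_mx_C.
    by rewrite mulmxDr mulmxA mul_mx_scalar.
  (* For [i = 0] the Horner polynomial is q itself, which annihilates [a] by Cayley-Hamilton;
     otherwise the vector is the preceding row of [E]. *)
  case: i => -[|i] lt_ir /=.
    rewrite drop_poly0l Cayley_Hamilton mulmx0.
    suff -> : row (Ordinal lt_ir) (\matrix_(i, j) (j.+1 == i :> nat)%:R)
        = 0 :> 'rV[K]_r.+1.
      by rewrite mul0mx.
    by apply/rowP => j; rewrite !mxE.
  have lt_i : (i < r.+1)%N by rewrite ltnW.
  have -> : row (Ordinal lt_ir) (\matrix_(i, j) (j.+1 == i :> nat)%:R)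
      = delta_mx 0 (Ordinal lt_i) :> 'rV[K]_r.+1.
    by apply/rowP => j; rewrite !mxE eqxx -val_eqE.
  by rewrite -rowE rowK.
have uE : E \in unitmx.
  rewrite -row_full_unit; apply: gen_va; last by rewrite E_a submxMl.
  by rewrite -lastE submxMl.
(* In the basis [E] this gain is the difference of the coefficients of q and p, so the last column
   of the cocompanion matrix passes from [-q] to [-p]. *)
exists (invmx E *m ((\col_i q`_i) - (\col_i p`_i))).
rewrite -[RHS](char_poly_cocompanion p_monic size_p).
apply: (char_poly_sim uE).
rewrite mulmxDr E_a !mulmxA mulmxV // mul1mx /cocompanion !mulmxBl -!mulmxA lastE.
by rewrite addrA subrK.
Qed.

Lemma pole_placement (K : fieldType) m r (N : 'M[K]_r) (G : 'M[K]_(r, m))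
    (p : {poly K}) :
  generates G^T N^T -> p \is monic -> size p = r.+1 ->
  exists Z : 'M[K]_(m, r), char_poly (N - G *m Z) = p.
Proof.
move=> /generates_feedback[w [Z0 gen_w]] p_monic size_p.
have [g def_p] := pole_placement_cyclic gen_w p_monic size_p.
(* Heymann's feedback and the single-input gain add up to one feedback for the transposed pair. *)
exists (- (Z0 + g *m w)^T).
rewrite mulmxN opprK -char_poly_tr linearD /= trmx_mul trmxK.
by rewrite mulmxDl addrA -mulmxA.
Qed.

(** The orthogonal [W] of a proper stable subspace containing the rows of [G^T] satisfies
    [W *m G = 0] and [W *m N = M *m W]. Over the closed field [M] has an eigenvector [y], and
    [y *m W] is then a left eigenvector of [N] killed by [G], against the rank condition at its
    eigenvalue. *)
Lemma hautus_generates (K : fieldType) (C : closedFieldType)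
    (f : {rmorphism K -> C}) m r (N : 'M[K]_r) (G : 'M[K]_(r, m)) :
  (forall s : C, row_free (row_mx (s%:M - map_mx f N) (map_mx f G))) ->
  generates G^T N^T.
Proof.
move=> hautus S /submxP[D defG] /submxP[D' defSN].
pose W := row_base (kermx S^T).
have WS0 : W *m S^T = 0.
  by apply/eqP; rewrite -sub_kermx eq_row_base.
have WG0 : W *m G = 0.
  by rewrite -[G]trmxK defG trmx_mul mulmxA WS0 mul0mx.
have [M defWN] : exists M, W *m N = M *m W.
  apply/submxP; rewrite eq_row_base sub_kermx -mulmxA -[N]trmxK -trmx_mul defSN.
  by rewrite trmx_mul mulmxA WS0 mul0mx.
rewrite /row_full -mxrank_tr -/(row_free S^T) -kermx_eq0 -mxrank_eq0.
rewrite -leqn0 leqNgt; apply/negP => rank_gt0.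
have [s] : exists s, root (char_poly (map_mx f M)) s.
  by apply/closed_rootP; rewrite size_char_poly eqSS -lt0n.
rewrite -eigenvalue_root_char => /eigenvalueP[y yM nz_y].
pose w := y *m map_mx f W.
have w0 : w = 0.
  apply: (row_free_inj (hautus s)).
  rewrite mul0mx mul_mx_row mulmxBr mul_mx_scalar /w -!mulmxA -!map_mxM WG0 defWN.
  by rewrite map_mx0 mulmx0 map_mxM mulmxA yM -scalemxAl subrr row_mx0.
have fW_free : row_free (map_mx f W) by rewrite row_free_map; exact: row_base_free.
by case/eqP: nz_y; apply: (row_free_inj fW_free); rewrite mul0mx.
Qed.

(** * Differentiation of matrix functions and solutions of linear ODEs *)

Lemma is_derive_mxP (R : realFieldType) (V : normedModType R) m n
    (M : V -> 'M[R]_(m, n)) (dM : 'M[R]_(m, n)) (t v : V) :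
  is_derive t v M dM <->
  forall i j, is_derive t v (fun x => M x i j) (dM i j).
Proof.
split=> [[derM <-] i j|derMij].
  by rewrite derive_mx // mxE; apply: DeriveDef => //; exact: (derivable_mxP M t v).1.
have derM : derivable M t v by apply/derivable_mxP => i j; exact: ex_derive.
apply: DeriveDef => //; rewrite derive_mx //; apply/matrixP => i j.
by rewrite mxE; exact: derive_val.
Qed.

Lemma is_derive_mulmxl (R : realFieldType) (V : normedModType R) p m n
    (F : 'M[R]_(p, m)) (x : V -> 'M[R]_(m, n)) (dx : 'M[R]_(m, n)) (t v : V) :
  is_derive t v x dx -> is_derive t v (fun s => F *m x s) (F *m dx).
Proof.
move=> /is_derive_mxP derx; apply/is_derive_mxP => i j.
have -> : (fun s => (F *m x s) i j) =
    \sum_k (F i k \*: (fun s => x s k j)) :> (V -> R).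
  by apply/funext => s; rewrite fct_sumE mxE.
rewrite mxE; apply: is_derive_sum => k; exact: is_deriveZ.
Qed.

Section LinearODE.
Variables (R : realType) (n : nat) (A : 'M[R]_n).

(** Taylor coefficients at 0 of the [i]-th entry of exp(tA) x0. Differentiating the series amounts
    to replacing [x0] by [A *m x0]. *)
Let coef (x0 : 'cV[R]_n) (i : 'I_n) : R^nat :=
  fun k => (iter k (mulmx A) x0) i 0 / k`!%:R.

Let coef_diffs x0 i : pseries_diffs (coef x0 i) = coef (A *m x0) i.
Proof.
apply/funext => k; rewrite /pseries_diffs /coef -iterSr factS natrM invfM.
by rewrite mulrCA mulVKf // pnatr_eq0.
Qed.

Let iter_bound (x0 : 'cV[R]_n) k i :
  `|(iter k (mulmx A) x0) i 0| <=
  (\sum_j `|x0 j 0|) * (\sum_i \sum_j `|A i j|) ^+ k.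
Proof.
elim: k i => [|k IHk] i /=.
  by rewrite expr0 mulr1 (bigD1 i) //= lerDl sumr_ge0.
set C := \sum_i _ in IHk *; rewrite mxE (le_trans (ler_norm_sum _ _ _)) //.
rewrite exprS mulrCA.
apply: (@le_trans _ _ (\sum_j `|A i j| * ((\sum_j `|x0 j 0|) * C ^+ k))).
  by apply: ler_sum => j _; rewrite normrM ler_wpM2l.
have C_ge0 : 0 <= C by apply: sumr_ge0 => l _; apply: sumr_ge0.
rewrite -mulr_suml; apply: ler_wpM2r.
  by apply: mulr_ge0; [exact: sumr_ge0|exact: exprn_ge0].
rewrite /C [leRHS](bigD1 i) //= lerDl.
by apply: sumr_ge0 => l _; apply: sumr_ge0.
Qed.

Let coef_cvg x0 i t : cvgn (pseries (coef x0 i) t).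
Proof.
(* The series is dominated by that of [M] exp([C] |t|). *)
pose C := \sum_i \sum_j `|A i j|; pose M := \sum_j `|x0 j 0|.
apply: normed_cvg.
apply: (@series_le_cvg _ _ (fun k => M * exp_coeff (C * `|t|) k)) => [k|k|k|].
- exact: normr_ge0.
- rewrite mulr_ge0 ?sumr_ge0 // /exp_coeff /= divr_ge0 // exprn_ge0 // mulr_ge0 //.
  by apply: sumr_ge0 => l _; apply: sumr_ge0.
- rewrite /coef /exp_coeff /= !normrM normfV normr_nat normrX exprMn.
  rewrite mulrAC !mulrA ler_wpM2r // ler_wpM2r ?exprn_ge0 //; exact: iter_bound.
- exact/is_cvg_seriesZ/is_cvg_series_exp_coeff.
Qed.

Lemma linear_ode_solution (x0 : 'cV[R]_n) :
  exists x : R -> 'cV[R]_n,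
    x 0 = x0 /\ forall t : R, is_derive t 1 x (A *m x t).
Proof.
exists (fun t => \col_i limn (pseries (coef x0 i) t)); split=> [|t].
  apply/colP => i; rewrite mxE; apply/cvg_lim => //.
  apply: cvg_near_cst; exists 1%N => // -[|k] // _.
  rewrite /pseries /series /= big_nat_recl // expr0 mulr1 big1 => [|l _].
    by rewrite addr0 /coef /= divr1.
  by rewrite expr0n mulr0.
apply/is_derive_mxP => i j; rewrite ord1 {j} mxE.
under eq_bigr do rewrite mxE.
(* A finite combination of the limits is the limit of the combined partial sums. *)
have -> : \sum_j A i j * limn (pseries (coef x0 j) t) =
    limn (pseries (coef (A *m x0) i) t).
  apply/esym/cvg_lim => //.
  have -> : pseries (coef (A *m x0) i) t =
      (fun k => \sum_j A i j * pseries (coef x0 j) t k).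
    apply/funext => k; rewrite /pseries /series /=.
    under [RHS]eq_bigr do rewrite mulr_sumr.
    rewrite exchange_big; apply: eq_bigr => l _ /=.
    rewrite /coef -iterSr iterS mxE !mulr_suml; apply: eq_bigr => j _.
    by rewrite !mulrA.
  apply: cvg_big => [|j _]; first exact: add_continuous.
  by apply: cvgM; [exact: cvg_cst|exact: coef_cvg].
rewrite -coef_diffs.
have -> : (fun s => (\col_i0 limn (pseries (coef x0 i0) s)) i 0) =
    (fun s => limn (pseries (coef x0 i) s)).
  by apply/funext => s; rewrite mxE.
apply: (@pseries_snd_diffs _ _ (`|t| + 1)); rewrite ?coef_diffs; try exact: coef_cvg.
by rewrite [ltRHS]ger0_norm// addrC -subr_gt0 addrK.
Qed.

End LinearODE.

(** * Real target polynomials, quotient dynamics and the equivalence *)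

Lemma conj_closed_real_poly (R : rcfType) (L : seq R[i]) :
  conj_closed L ->
  exists p : {poly R}, map_poly (real_complex R) p = \prod_(z <- L) ('X - z%:P).
Proof.
move=> conjL; set P := \prod_(z <- L) _.
(* Conjugation permutes the factors, so it fixes every coefficient of [P], which is therefore
   real. *)
have conjP : map_poly (@conjc R) P = P.
  rewrite rmorph_prod /= -[RHS](perm_big _ conjL) big_map.
  by apply: eq_bigr => z _; rewrite rmorphB /= map_polyX map_polyC.
exists (\poly_(k < size P) complex.Re P`_k); apply/polyP => k.
rewrite coef_map coef_poly; case: ltnP => [_|le_k]; last by rewrite nth_default ?rmorph0.
have /eqP : (map_poly (@conjc R) P)`_k = P`_k by rewrite conjP.
rewrite coef_map /=; case: P`_k => a b /=.
rewrite eq_complex /= eqxx /= => /eqP Nbb; congr Complex; apply/esym/eqP.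
have : b *+ 2 == 0 by rewrite mulr2n -{1}Nbb addNr.
by rewrite mulrn_eq0.
Qed.

(** A solution starts at any given [y]; comparing the two derivatives of [F *m x] at time 0 gives
    the identity on every [y], hence between matrices. The converse is differentiation of
    [F *m x]. *)
Lemma trajectory_quotientP (R : realType) n m r (A : 'M[R]_n) (B : 'M[R]_(n, m))
    (F : 'M[R]_(r, n)) (Z : 'M[R]_(m, r)) (M : 'M[R]_r) :
  (forall x : R -> 'cV[R]_n,
     trajectory A B (fun t => - (Z *m F *m x t)) x ->
     forall t : R, is_derive t 1 (fun s => F *m x s) (M *m (F *m x t))) <->
  F *m A - F *m B *m Z *m F = M *m F.
Proof.
have closed_loop (y : 'cV[R]_n) :
    A *m y + B *m - (Z *m F *m y) = (A - B *m Z *m F) *m y.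
  by rewrite mulmxN mulmxBl !mulmxA.
split=> [quotient|eqM x traj_x t].
  have eqMy (y : 'cV[R]_n) : (F *m A - F *m B *m Z *m F) *m y = (M *m F) *m y.
    have [x [x0 ode_x]] := linear_ode_solution (A - B *m Z *m F) y.
    have traj_x : trajectory A B (fun t => - (Z *m F *m x t)) x.
      by move=> t; rewrite closed_loop.
    have dFx := is_derive_mulmxl F (ode_x 0).
    have dFx' := quotient x traj_x 0.
    rewrite -[RHS]mulmxA -x0 -(@derive_val _ _ _ _ _ _ _ dFx').
    by rewrite (@derive_val _ _ _ _ _ _ _ dFx) !mulmxA mulmxBr !mulmxA.
  apply/matrixP => i j; have /colP/(_ i) := eqMy (delta_mx j 0).
  by rewrite -!colE !mxE.
have -> : M *m (F *m x t) = F *m (A *m x t + B *m - (Z *m F *m x t)).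
  by rewrite closed_loop !mulmxA -eqM mulmxBr !mulmxA.
exact: is_derive_mulmxl.
Qed.

(** The left matrix is the right one times diag([F], 1), whose rows are free. *)
Lemma rank_row_mx_mulmx_free (K : fieldType) n m r (F : 'M[K]_(r, n))
    (N : 'M[K]_r) (G : 'M[K]_(r, m)) :
  row_free F -> \rank (row_mx (N *m F) G) = \rank (row_mx N G).
Proof.
move=> F_free.
have D_free : row_free (block_mx F 0 0 (1%:M : 'M[K]_m)).
  by rewrite /row_free rank_diag_block_mx mxrank1 (eqP F_free).
by rewrite -(mxrankMfree _ D_free) mul_row_block !mulmx0 mulmx1 addr0 add0r.
Qed.

Theorem theorem3 (R : realType) (n m r : nat)
    (A : 'M[R]_n) (B : 'M[R]_(n, m)) (F : 'M[R]_(r, n)) (hF : \rank F = r) :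
  arbitrary_rate_by_pole_placement A B F <->
  (\rank (col_mx (F *m A) F) = \rank F /\
   forall s : R[i],
     \rank (row_mx (s *: complexify F - complexify (F *m A))
                   (complexify (F *m B))) = \rank F).
Proof.
have F_free : row_free F by apply/eqP.
(* Since [s F - F A = (s - N) F], the free rows of [F] can be cancelled from the rank. *)
have hautus_free (N : 'M[R]_r) (s : R[i]) : F *m A = N *m F ->
    (\rank (row_mx (s *: complexify F - complexify (F *m A))
                   (complexify (F *m B))) == \rank F)
    = row_free (row_mx (s%:M - complexify N) (complexify (F *m B))).
  move=> ->; rewrite {2}/complexify map_mxM -mul_scalar_mx -mulmxBl.
  rewrite rank_row_mx_mulmx_free; first by rewrite hF.
  by rewrite row_free_map.
split=> [placeable|[rankFA hautus] L size_L _ conjL].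
  (* The multiset of [r] copies of a real [c] is closed under conjugation and leaves [c] as the only
     possible eigenvalue of [M]. *)
  have place (c : R) : c < 0 -> exists (Z : 'M[R]_(m, r)) (M : 'M[R]_r),
      F *m A - F *m B *m Z *m F = M *m F /\
      forall s : R[i], eigenvalue (complexify M) s -> s = c%:C%C.
    move=> c_lt0; have [|||Z [M [/trajectory_quotientP eqM multM]]] :=
      placeable (nseq r c%:C%C).
    - by rewrite size_nseq.
    - by move=> z /nseqP[-> _].
    - by rewrite /conj_closed map_nseq conjc_real.
    exists Z, M; split=> // s; rewrite eigenvalue_root_char => root_s.
    have : s \in nseq r c%:C%C.
      rewrite -has_pred1 has_count -multM /alg_mult -XsubC_dvd.
        by rewrite dvdp_XsubCl.
      by rewrite monic_neq0 ?char_poly_monic.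
    by case/nseqP.
  have [|Z1 [M1 [eqM1 spec1]]] := place (-1); first by rewrite oppr_lt0.
  have [|Z2 [M2 [eqM2 spec2]]] := place (-2); first by rewrite oppr_lt0.
  pose N := M1 + F *m B *m Z1.
  have defN : F *m A = N *m F by rewrite mulmxDl -eqM1 subrK.
  split=> [|s].
    rewrite -addsmxE (addsmx_idPr _) // defN; exact: submxMl.
  apply/eqP; rewrite (hautus_free N) // -kermx_eq0.
  (* A rank drop at [s] yields a left eigenvector [w] of [N] killed by [F *m B], which no feedback
     can move. *)
  apply/negPn/negP => /rowV0Pn[w /sub_kermxP w0 nz_w].
  have [wN wG] : w *m (s%:M - complexify N) = 0 /\ w *m complexify (F *m B) = 0.
    by apply: eq_row_mx; rewrite -mul_mx_row w0 row_mx0.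
  have spec (Z : 'M[R]_(m, r)) M : F *m A - F *m B *m Z *m F = M *m F ->
      eigenvalue (complexify M) s.
    rewrite defN -mulmxBl => /(row_free_inj F_free) <-.
    apply/eigenvalueP; exists w => //; rewrite /complexify map_mxB mulmxBr.
    rewrite map_mxM mulmxA wG mul0mx subr0.
    by move/eqP: wN; rewrite mulmxBr mul_mx_scalar subr_eq0 => /eqP.
  have := spec2 s (spec _ _ eqM2); rewrite (spec1 s (spec _ _ eqM1)) => /complexI/eqP.
  by rewrite eqr_opp (eqr_nat R 1 2).
(* The row space of [F] lies in that of the stacked matrix; equal ranks make them coincide, so it
   contains the rows of [F *m A]. *)
have [N defN] : exists N, F *m A = N *m F.
  apply/submxP; have sub_F : (F <= col_mx (F *m A) F)%MS by rewrite -addsmxE addsmxSr.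
  rewrite (submx_trans _ (_ : col_mx (F *m A) F <= F)%MS) //.
    by rewrite -addsmxE addsmxSl.
  by rewrite -(mxrank_leqif_sup sub_F) rankFA.
have gen_N : generates (F *m B)^T N^T.
  apply: (@hautus_generates _ _ (real_complex R)) => s.
  by rewrite -(hautus_free N s defN) hautus.
have [p def_p] := conj_closed_real_poly conjL.
have [||Z def_char] := pole_placement gen_N (p := p).
- by rewrite -(map_monic (real_complex R)) def_p monic_prod_XsubC.
- by rewrite -(size_map_poly (real_complex R)) def_p size_prod_XsubC size_L.
exists Z, (N - F *m B *m Z); split=> [|z].
  by apply/trajectory_quotientP; rewrite defN mulmxBl.
by rewrite /alg_mult /complexify -map_char_poly def_char def_p mu_prod_XsubC.
Qed.
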